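(* Let $0<q<1$. For complex numbers $a,b,c,d,\alpha,\beta,\gamma,\delta$ with $\mathrm{Re}(a+b+c+d+1+\alpha-\beta-\gamma-\delta)>0$, and such that every $q^2$-gamma value occurring below is evaluated at a point that is not a non-positive integer, put $A=2(a+b+c+d+1+\alpha-\beta-\gamma-\delta)$. Then \[ \sum_{n=0}^{\infty}\frac{(1-q^{4n+2a+2\alpha})(\alpha|q^{2})_{a+n}(\beta|q^{2})_{n-b}(\gamma|q^{2})_{n-c}(\delta|q^{2})_{n-d}}{(1-q^{2})[n]_{q^{2}}!\,(1+\alpha-\beta|q^{2})_{a+b+n}(1+\alpha-\gamma|q^{2})_{a+c+n}(1+\alpha-\delta|q^{2})_{a+d+n}}\,q^{An} \] \[ =\frac{\Gamma_{q^{2}}(1+\alpha-\beta)\Gamma_{q^{2}}(1+\alpha-\gamma)\Gamma_{q^{2}}(1+\alpha-\delta)\Gamma_{q^{2}}(2+\alpha-\beta-\gamma-\delta)}{\Gamma_{q^{2}}(\alpha)\Gamma_{q^{2}}(1+\alpha-\beta-\gamma)\Gamma_{q^{2}}(1+\alpha-\beta-\delta)\Gamma_{q^{2}}(1+\alpha-\gamma-\delta)} \times\frac{(\beta|q^{2})_{-b}(\gamma|q^{2})_{-c}(\delta|q^{2})_{-d}(2+\alpha-\beta-\gamma-\delta|q^{2})_{a+b+c+d-1}}{(1+\alpha-\beta-\gamma|q^{2})_{a+b+c}(1+\alpha-\beta-\delta|q^{2})_{a+b+d}(1+\alpha-\gamma-\delta|q^{2})_{a+c+d}}. \]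
   Context: Let $0<q<1$ and write $q^{x}=e^{x\log q}$ for complex $x$. Set $(z;q)_\infty=\prod_{k\ge0}(1-zq^k)$. The $q^2$-gamma function is $\Gamma_{q^2}(x)=\frac{(q^2;q^2)_\infty}{(q^{2x};q^2)_\infty}(1-q^2)^{1-x}$. For complex $x,\alpha$, the general $q$-shifted factorial is $(x|q^2)_\alpha=\Gamma_{q^2}(x+\alpha)/\Gamma_{q^2}(x)$. The $q$-integer is $[z]_{q^2}=\frac{1-q^{2z}}{1-q^2}$, and $[0]_{q^2}!=1$, $[n]_{q^2}!=\prod_{k=1}^n[k]_{q^2}$.
   Formalization: The condition that no q²-gamma argument is a non-positive integer is strengthened to: no argument is a pole, i.e. q^{2x+2k}≠1 for all k≥0; otherwise complex points such as x = iπ/log q would leave Γ_{q²}(x) undefined. *)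

(* Defs.v *)
From Stdlib Require Import Reals ClassicalEpsilon.
Open Scope R_scope.

Definition Cplx : Type := (R * R)%type.
Definition RtoC (r : R) : Cplx := (r, 0).
Definition Cre (z : Cplx) : R := fst z.
Definition Cim (z : Cplx) : R := snd z.
Definition Cadd (z w : Cplx) : Cplx := (fst z + fst w, snd z + snd w).
Definition Copp (z : Cplx) : Cplx := (- fst z, - snd z).
Definition Csub (z w : Cplx) : Cplx := Cadd z (Copp w).
Definition Cmul (z w : Cplx) : Cplx :=
  (fst z * fst w - snd z * snd w, fst z * snd w + snd z * fst w).
Definition Cinv (z : Cplx) : Cplx :=
  (fst z / (fst z ^ 2 + snd z ^ 2), - snd z / (fst z ^ 2 + snd z ^ 2)).
Definition Cdiv (z w : Cplx) : Cplx := Cmul z (Cinv w).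
Definition Cmod (z : Cplx) : R := sqrt (fst z ^ 2 + snd z ^ 2).
Definition Cexp (z : Cplx) : Cplx := (exp (fst z) * cos (snd z), exp (fst z) * sin (snd z)).

Declare Scope C_scope.
Delimit Scope C_scope with C.
Infix "+" := Cadd : C_scope.
Infix "-" := Csub : C_scope.
Infix "*" := Cmul : C_scope.
Infix "/" := Cdiv : C_scope.
Notation "- x" := (Copp x) : C_scope.

Fixpoint Cprod (n : nat) (f : nat -> Cplx) : Cplx :=
  match n with
  | O => RtoC 1
  | S m => Cmul (Cprod m f) (f m)
  end.

Fixpoint Csum (n : nat) (f : nat -> Cplx) : Cplx :=
  match n with
  | O => RtoC 0
  | S m => Cadd (Csum m f) (f m)
  end.

Definition Cseq_cv (u : nat -> Cplx) (l : Cplx) : Prop :=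
  forall eps : R, eps > 0 -> exists N : nat, forall n : nat, (n >= N)%nat ->
    Cmod (Csub (u n) l) < eps.
Definition Clim (u : nat -> Cplx) : Cplx :=
  epsilon (inhabits (RtoC 0)) (fun l => Cseq_cv u l).
Definition Cseries_cv (f : nat -> Cplx) (l : Cplx) : Prop :=
  Cseq_cv (fun N => Csum (S N) f) l.

Definition qpow (q : R) (x : Cplx) : Cplx := Cexp (Cmul x (RtoC (ln q))).

Definition qpoch_inf (z : Cplx) (p : R) : Cplx :=
  Clim (fun N => Cprod N (fun k => Csub (RtoC 1) (Cmul z (RtoC (p ^ k))))).

Definition qgamma2 (q : R) (x : Cplx) : Cplx :=
  Cmul (Cdiv (qpoch_inf (RtoC (q ^ 2)) (q ^ 2))
             (qpoch_inf (qpow q (Cmul (RtoC 2) x)) (q ^ 2)))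
       (Cexp (Cmul (Csub (RtoC 1) x) (RtoC (ln (1 - q ^ 2))))).

Definition qshift2 (q : R) (x a : Cplx) : Cplx :=
  Cdiv (qgamma2 q (Cadd x a)) (qgamma2 q x).

Definition qint2 (q : R) (z : Cplx) : Cplx :=
  Cdiv (Csub (RtoC 1) (qpow q (Cmul (RtoC 2) z))) (RtoC (1 - q ^ 2)).

Definition qfact2 (q : R) (n : nat) : Cplx :=
  Cprod n (fun k => qint2 q (RtoC (INR (S k)))).

(** x is a pole of Gamma_{q^2}: some factor 1 - q^{2x} (q^2)^k of the
    denominator (q^{2x};q^2)_inf vanishes. *)
Definition qgamma2_pole (q : R) (x : Cplx) : Prop :=
  exists k : nat, Cmul (qpow q (Cmul (RtoC 2) x)) (RtoC ((q ^ 2) ^ k)) = RtoC 1.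

Definition qshift2_ok (q : R) (x s : Cplx) : Prop :=
  ~ qgamma2_pole q x /\ ~ qgamma2_pole q (Cadd x s).

(* Main.v *)
(** With p = q^2, A = p^(al+a), B = p^(be-b), C = p^(ga-c), D = p^(de-d), the
    series is, up to a constant factor, the nonterminating very-well-poised
    6phi5 series of argument z = pA/(BCD), |z| < 1; call it S(A) and let R(A) be
    its product side.  Replacing A by pA multiplies z by p, and the difference
    of the n-th terms of S(A) and (R(A)/R(pA)) S(pA) is a telescoping difference
    G(n+1) - G(n) with G(0) = 0 and G(n) -> 0.  Hence
    S(A) = (R(A)/R(p^k A)) S(p^k A) for all k, and both S(p^k A) and R(p^k A)
    tend to 1. *)

From Coquelicot Require Complex.
From Coquelicot Require Import Hierarchy Rbar Lim_seq Series.
From Stdlib Require Import Lra Lia ClassicalEpsilon.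
Require Import Defs.
From Stdlib Require Import Reals.
Open Scope R_scope.

(** Shifting A alone works because B, C, D stay fixed while A and the argument z are both driven to
    0: every term but the zeroth dies, and that one is 1 - p^k A. The price is uniformity in k: the
    reciprocals of (p^(k+1) A/B; p)_n and its companions need one bound for all k and n, which comes
    from (u p^k; p)_n = (u; p)_(k+n) / (u; p)_k. The series is kept multiplied by 1 - A, so A = 1 is
    allowed and the product side starts with (A; p)_inf instead of (pA; p)_inf. The passage to gamma
    values rests on Gamma(u+n) = Gamma(u) (q^(2u); q^2)_n / (1-q^2)^n, which splits each summand
    into a constant and a term of S(A). The powers (1-q^2)^n cancel: four from the upper shifted
    factorials against three from the lower ones and one from the q-factorial. On the product side
    the exponents of 1-q^2 add up to exactly 1, which absorbs the 1-q^2 in the denominator of the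
    summand. *)

Lemma Cplx_field_theory :
  field_theory (RtoC 0) (RtoC 1) Cadd Cmul Csub Copp Cdiv Cinv eq.
Proof. exact Complex.C_field_theory. Qed.
Add Field Cplx_field : Cplx_field_theory.

Lemma RtoC_mul (x y : R) : RtoC (x * y) = (RtoC x * RtoC y)%C.
Proof. apply Complex.RtoC_mult. Qed.

Lemma RtoC_neq0 (x : R) : x <> 0 -> RtoC x <> RtoC 0.
Proof. intros H E. apply H. now injection E. Qed.

Lemma Cmul_neq0 (x y : Cplx) :
  x <> RtoC 0 -> y <> RtoC 0 -> (x * y)%C <> RtoC 0.
Proof. exact (Complex.Cmult_neq_0 x y). Qed.

Lemma Cinv_neq0 (x : Cplx) : x <> RtoC 0 -> Cinv x <> RtoC 0.
Proof.
  intros H E. apply (RtoC_neq0 1); [lra|].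
  transitivity (x * Cinv x)%C; [field; exact H | rewrite E; ring].
Qed.

Lemma Cdiv_neq0 (x y : Cplx) :
  x <> RtoC 0 -> y <> RtoC 0 -> (x / y)%C <> RtoC 0.
Proof. intros Hx Hy. apply Cmul_neq0; [exact Hx | now apply Cinv_neq0]. Qed.

Lemma Cmod_triangle (x y : Cplx) : Cmod (x + y)%C <= Cmod x + Cmod y.
Proof. exact (Complex.Cmod_triangle x y). Qed.

Lemma Cmod_opp (x : Cplx) : Cmod (- x)%C = Cmod x.
Proof. exact (Complex.Cmod_opp x). Qed.

Lemma Cmod_mul (x y : Cplx) : Cmod (x * y)%C = Cmod x * Cmod y.
Proof. exact (Complex.Cmod_mult x y). Qed.

Lemma Cmod_inv (x : Cplx) : x <> RtoC 0 -> Cmod (Cinv x) = / Cmod x.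
Proof. exact (Complex.Cmod_inv x). Qed.

Lemma Cmod_ge0 (x : Cplx) : 0 <= Cmod x.
Proof. exact (Complex.Cmod_ge_0 x). Qed.

Lemma Cmod_gt0 (x : Cplx) : x <> RtoC 0 -> 0 < Cmod x.
Proof. exact (proj1 (Complex.Cmod_gt_0 x)). Qed.

Lemma Cmod_RtoC (x : R) : Cmod (RtoC x) = Rabs x.
Proof. exact (Complex.Cmod_R x). Qed.

Lemma Cmod_RtoC_pos (x : R) : 0 <= x -> Cmod (RtoC x) = x.
Proof. intros H. now rewrite Cmod_RtoC, Rabs_pos_eq. Qed.

Lemma Cmod_sub_sym (x y : Cplx) : Cmod (x - y)%C = Cmod (y - x)%C.
Proof. rewrite <- Cmod_opp. f_equal. ring. Qed.

Lemma Cmod_fst (x : Cplx) : Rabs (fst x) <= Cmod x.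
Proof. exact (Complex.re_le_Cmod x). Qed.

Lemma Cmod_snd (x : Cplx) : Rabs (snd x) <= Cmod x.
Proof.
  eapply Rle_trans; [apply Rmax_r | exact (Complex.Rmax_Cmod x)].
Qed.

Lemma Cmod_le_add (x : Cplx) : Cmod x <= Rabs (fst x) + Rabs (snd x).
Proof.
  assert (E : x = (RtoC (fst x) + (0, 1)%R * RtoC (snd x))%C).
  { destruct x as [x y]. unfold RtoC, Cadd, Cmul. simpl. f_equal; ring. }
  rewrite E at 1. eapply Rle_trans; [apply Cmod_triangle|].
  rewrite Cmod_mul, !Cmod_RtoC.
  assert (H : Cmod (0, 1) = 1).
  { unfold Cmod. simpl fst; simpl snd.
    replace (0 ^ 2 + 1 ^ 2) with 1 by ring. apply sqrt_1. }
  rewrite H. lra.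
Qed.

(** * Limits of complex sequences *)

(** Bridge to real analysis: uniqueness and the algebraic limit laws below are inherited
    componentwise from [is_lim_seq]. *)
Lemma Cseq_cv_components (u : nat -> Cplx) (l : Cplx) :
  Cseq_cv u l <->
  is_lim_seq (fun n => fst (u n)) (Finite (fst l)) /\
  is_lim_seq (fun n => snd (u n)) (Finite (snd l)).
Proof.
  split.
  - intros H; split; apply is_lim_seq_spec; intros [e He]; destruct (H e He) as [N HN];
      exists N; intros n Hn; simpl;
      (eapply Rle_lt_trans; [|exact (HN n Hn)]).
    + exact (Cmod_fst (u n - l)%C).
    + exact (Cmod_snd (u n - l)%C).
  - intros [H1 H2] e He.
    apply is_lim_seq_spec in H1. apply is_lim_seq_spec in H2.
    assert (He2 : 0 < e / 2) by lra.
    destruct (H1 (mkposreal _ He2)) as [N1 HN1].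
    destruct (H2 (mkposreal _ He2)) as [N2 HN2]. simpl in *.
    exists (max N1 N2). intros n Hn.
    eapply Rle_lt_trans; [apply Cmod_le_add|].
    assert (K1 := HN1 n ltac:(lia)). assert (K2 := HN2 n ltac:(lia)).
    unfold Csub, Cadd, Copp; simpl. unfold Rminus in *. lra.
Qed.

Lemma Cseq_cv_unique (u : nat -> Cplx) (l m : Cplx) :
  Cseq_cv u l -> Cseq_cv u m -> l = m.
Proof.
  intros [H1 H2]%Cseq_cv_components [H3 H4]%Cseq_cv_components.
  apply is_lim_seq_unique in H1, H2, H3, H4.
  rewrite H1 in H3. rewrite H2 in H4.
  injection H3; injection H4. destruct l, m; simpl; congruence.
Qed.

Lemma Cseq_cv_ext (u v : nat -> Cplx) (l : Cplx) :
  (forall n, u n = v n) -> Cseq_cv u l -> Cseq_cv v l.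
Proof.
  intros E H e He. destruct (H e He) as [N HN]. exists N.
  intros n Hn. rewrite <- E. auto.
Qed.

Lemma Cseq_cv_const (l : Cplx) : Cseq_cv (fun _ => l) l.
Proof. apply Cseq_cv_components; split; apply is_lim_seq_const. Qed.

Lemma Cseq_cv_add (u v : nat -> Cplx) (l m : Cplx) :
  Cseq_cv u l -> Cseq_cv v m -> Cseq_cv (fun n => (u n + v n)%C) (l + m)%C.
Proof.
  intros [H1 H2]%Cseq_cv_components [H3 H4]%Cseq_cv_components.
  apply Cseq_cv_components; split; simpl; now apply is_lim_seq_plus'.
Qed.

Lemma Cseq_cv_mul (u v : nat -> Cplx) (l m : Cplx) :
  Cseq_cv u l -> Cseq_cv v m -> Cseq_cv (fun n => (u n * v n)%C) (l * m)%C.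
Proof.
  intros [H1 H2]%Cseq_cv_components [H3 H4]%Cseq_cv_components.
  apply Cseq_cv_components; split; simpl;
    [apply is_lim_seq_minus' | apply is_lim_seq_plus']; now apply is_lim_seq_mult'.
Qed.

Lemma Cseq_cv_inv (u : nat -> Cplx) (l : Cplx) :
  l <> RtoC 0 -> Cseq_cv u l -> Cseq_cv (fun n => Cinv (u n)) (Cinv l).
Proof.
  intros Hl [H1 H2]%Cseq_cv_components.
  assert (Hd : fst l ^ 2 + snd l ^ 2 <> 0).
  { intros E. apply Hl. destruct l as [x y]. simpl in E. unfold RtoC. f_equal; nra. }
  assert (H3 : is_lim_seq (fun n => fst (u n) ^ 2 + snd (u n) ^ 2)
                 (Finite (fst l ^ 2 + snd l ^ 2))).
  { simpl. apply is_lim_seq_plus'; repeat apply is_lim_seq_mult'; trivial;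
      apply is_lim_seq_const. }
  apply Cseq_cv_components; split; unfold Cinv; simpl fst; simpl snd;
    apply is_lim_seq_div'; trivial.
  apply (is_lim_seq_opp _ (Finite (snd l))). exact H2.
Qed.

Lemma Cseq_cv_div (u v : nat -> Cplx) (l m : Cplx) :
  m <> RtoC 0 -> Cseq_cv u l -> Cseq_cv v m ->
  Cseq_cv (fun n => (u n / v n)%C) (l / m)%C.
Proof. intros Hm Hu Hv. apply Cseq_cv_mul; [exact Hu | now apply Cseq_cv_inv]. Qed.

Lemma Cseq_cv_incr (u : nat -> Cplx) (l : Cplx) :
  Cseq_cv u l -> Cseq_cv (fun n => u (S n)) l.
Proof.
  intros H e He. destruct (H e He) as [N HN]. exists N.
  intros n Hn. apply HN. lia.
Qed.

Lemma Cseq_cv_geom (u : nat -> Cplx) (l : Cplx) (K r : R) :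
  0 <= r < 1 -> (forall n, Cmod (u n - l)%C <= K * r ^ n) -> Cseq_cv u l.
Proof.
  intros Hr H.
  assert (HK : is_lim_seq (fun n => K * r ^ n) (Finite 0)).
  { replace 0 with (K * 0) by ring. apply is_lim_seq_mult'.
    - apply is_lim_seq_const.
    - apply is_lim_seq_geom. rewrite Rabs_pos_eq; lra. }
  apply is_lim_seq_spec in HK.
  intros e He. destruct (HK (mkposreal e He)) as [N HN]. exists N. intros n Hn.
  eapply Rle_lt_trans; [apply H|]. specialize (HN n Hn). simpl in HN.
  apply Rabs_def2 in HN. lra.
Qed.

(** Completeness in the form used twice below, for the infinite products and for the series: the
    series of increments is dominated by a geometric one in each component. *)
Lemma Cseq_cv_of_geom_steps (u : nat -> Cplx) (K r : R) :
  0 <= r < 1 -> (forall n, Cmod (u (S n) - u n)%C <= K * r ^ n) ->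
  exists l, Cseq_cv u l.
Proof.
  intros Hr H.
  assert (main : forall v : nat -> R,
    (forall n, Rabs (v (S n) - v n) <= K * r ^ n) ->
    exists l : R, is_lim_seq v (Finite l)).
  { intros v Hv.
    assert (Hs : ex_series (fun n => v (S n) - v n)).
    { apply (@ex_series_le R_AbsRing R_CompleteNormedModule _ (fun n => K * r ^ n)).
      - exact Hv.
      - apply (ex_series_scal_l (K := R_AbsRing) K (fun n => r ^ n)).
        apply ex_series_geom. rewrite Rabs_pos_eq; lra. }
    destruct Hs as [s Hs]. exists (s + v O).
    (* [sum_n] includes its last index, so the increments up to n add up to v (S n) - v 0; hence the
       passage to the shifted sequence. *)
    apply is_lim_seq_incr_1.
    apply is_lim_seq_ext with (fun n => sum_n (fun n => v (S n) - v n) n + v O).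
    - intros n. induction n as [|n IH].
      + rewrite sum_O. ring.
      + rewrite sum_Sn. unfold plus; simpl. lra.
    - apply is_lim_seq_plus'; [exact Hs | apply is_lim_seq_const]. }
  destruct (main (fun n => fst (u n))) as [x Hx].
  { intros n. eapply Rle_trans; [|apply (H n)]. exact (Cmod_fst (u (S n) - u n)%C). }
  destruct (main (fun n => snd (u n))) as [y Hy].
  { intros n. eapply Rle_trans; [|apply (H n)]. exact (Cmod_snd (u (S n) - u n)%C). }
  exists (x, y). now apply Cseq_cv_components.
Qed.

(** [Clim] is a choice operator and says nothing until some limit is known to exist; existence is
    what the geometric step bounds provide. *)
Lemma Clim_cv (u : nat -> Cplx) : (exists l, Cseq_cv u l) -> Cseq_cv u (Clim u).
Proof. intros H. apply (epsilon_spec (inhabits (RtoC 0)) (fun l => Cseq_cv u l) H). Qed.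

(** * q-shifted factorials *)

Definition qpoch (p : R) (z : Cplx) (n : nat) : Cplx :=
  Cprod n (fun k => RtoC 1 - z * RtoC (p ^ k))%C.

(** No factor of (z; p)_inf vanishes. With p = q^2 and z = q^(2x) this is literally the absence of a
    pole of Gamma_{q^2} at x. *)
Definition q_regular (p : R) (z : Cplx) : Prop :=
  forall k : nat, (z * RtoC (p ^ k))%C <> RtoC 1.

Lemma qpoch_S (p : R) (z : Cplx) (n : nat) :
  qpoch p z (S n) = (qpoch p z n * (RtoC 1 - z * RtoC (p ^ n)))%C.
Proof. reflexivity. Qed.

Lemma qpoch_add (p : R) (z : Cplx) (k n : nat) :
  qpoch p z (k + n) = (qpoch p z k * qpoch p (z * RtoC (p ^ k)) n)%C.
Proof.
  induction n as [|n IH].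
  - rewrite Nat.add_0_r. unfold qpoch at 3. simpl. ring.
  - rewrite Nat.add_succ_r, !qpoch_S, IH, pow_add, RtoC_mul. ring.
Qed.

Lemma qpoch_neq0 (p : R) (z : Cplx) (n : nat) :
  q_regular p z -> qpoch p z n <> RtoC 0.
Proof.
  intros H. induction n as [|n IH].
  - apply RtoC_neq0. lra.
  - apply Cmul_neq0; [exact IH|]. intros E. apply (H n).
    transitivity (RtoC 1 - (RtoC 1 - z * RtoC (p ^ n)))%C; [ring | rewrite E; ring].
Qed.

Lemma q_regular_shift (p : R) (z : Cplx) (k : nat) :
  q_regular p z -> q_regular p (z * RtoC (p ^ k))%C.
Proof.
  intros H n E. apply (H (k + n)%nat). rewrite <- E, pow_add, RtoC_mul. ring.
Qed.

Lemma pow_le1 (p : R) (n : nat) : 0 <= p <= 1 -> 0 <= p ^ n <= 1.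
Proof.
  intros Hp. induction n as [|n IH]; simpl; [lra|nra].
Qed.

Lemma q_regular_small (p : R) (z : Cplx) :
  0 < p < 1 -> Cmod z < 1 -> q_regular p z.
Proof.
  intros Hp Hz k E. apply (f_equal Cmod) in E.
  destruct (pow_le1 p k) as [H1 H2]; [lra|].
  rewrite Cmod_mul, !Cmod_RtoC_pos in E by lra.
  assert (K := Cmod_ge0 z). nra.
Qed.

(** A discrete Gronwall bound, from 1 + t <= exp t. It serves both the products and their
    reciprocals. *)
Lemma le_exp_of_geom_steps (w : nat -> R) (c r : R) :
  0 <= c -> 0 <= r < 1 -> (forall n, 0 <= w n) ->
  (forall n, w (S n) <= w n * (1 + c * r ^ n)) ->
  forall n, w n <= w O * exp (c / (1 - r)).
Proof.
  intros Hc Hr Hw H n.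
  (* The induction needs the partial geometric sum c (1 + r + ... + r^(n-1)) in the exponent; only
     afterwards is it enlarged to c / (1 - r). *)
  assert (K : w n <= w O * exp (c * (1 - r ^ n) / (1 - r))).
  { induction n as [|n IH].
    - simpl. replace (c * (1 - 1) / (1 - r)) with 0 by (field; lra).
      rewrite exp_0. lra.
    - eapply Rle_trans; [apply H|].
      replace (c * (1 - r ^ S n) / (1 - r))
        with (c * (1 - r ^ n) / (1 - r) + c * r ^ n) by (simpl; field; lra).
      rewrite exp_plus, <- Rmult_assoc.
      destruct (pow_le1 r n) as [H1 H2]; [lra|].
      apply Rmult_le_compat; trivial; [nra | apply exp_ineq1_le]. }
  eapply Rle_trans; [exact K|]. apply Rmult_le_compat_l; [apply Hw|].
  destruct (pow_le1 r n) as [H1 H2]; [lra|].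
  assert (E : c * (1 - r ^ n) / (1 - r) <= c / (1 - r)).
  { apply Rmult_le_compat_r; [apply Rlt_le, Rinv_0_lt_compat; lra | nra]. }
  destruct E as [E|E]; [left; now apply exp_increasing | right; now rewrite E].
Qed.

Lemma qpoch_le (p : R) (z : Cplx) (n : nat) :
  0 < p < 1 -> Cmod (qpoch p z n) <= exp (Cmod z / (1 - p)).
Proof.
  intros Hp.
  assert (K := le_exp_of_geom_steps (fun n => Cmod (qpoch p z n)) (Cmod z) p
    (Cmod_ge0 z) ltac:(lra) (fun n => Cmod_ge0 _)).
  replace (exp (Cmod z / (1 - p))) with (Cmod (qpoch p z 0) * exp (Cmod z / (1 - p))).
  - apply K. intros m. rewrite qpoch_S, Cmod_mul.
    apply Rmult_le_compat_l; [apply Cmod_ge0|].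
    eapply Rle_trans; [apply Cmod_triangle|].
    destruct (pow_le1 p m) as [H1 H2]; [lra|].
    rewrite Cmod_opp, Cmod_mul, !Cmod_RtoC_pos by lra. lra.
  - change (qpoch p z 0) with (RtoC 1). rewrite Cmod_RtoC_pos; lra.
Qed.

Lemma finite_lower_bound (f : nat -> R) (N : nat) :
  (forall n, 0 < f n) -> exists m, 0 < m /\ forall n, (n < N)%nat -> m <= f n.
Proof.
  intros H. induction N as [|N [m [Hm IH]]].
  - exists 1. split; [lra | lia].
  - exists (Rmin m (f N)). split; [now apply Rmin_glb_lt|].
    intros n Hn. destruct (Nat.eq_dec n N) as [->|].
    + apply Rmin_r.
    + eapply Rle_trans; [apply Rmin_l | apply IH; lia].
Qed.

(** The factors tend to 1, hence are at least 1/2 from some index on; the finitely many earlier ones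
    are nonzero by regularity. *)
Lemma q_factor_lower_bound (p : R) (z : Cplx) :
  0 < p < 1 -> q_regular p z ->
  exists m, 0 < m /\ forall n, m <= Cmod (RtoC 1 - z * RtoC (p ^ n))%C.
Proof.
  intros Hp Hz. assert (Z := Cmod_ge0 z).
  (* This threshold makes |z p^n| at most 1/2; the added 1 keeps it meaningful when z = 0. *)
  destruct (pow_lt_1_zero p ltac:(rewrite Rabs_pos_eq; lra) (/ (2 * (Cmod z + 1))))
    as [N HN]; [apply Rinv_0_lt_compat; lra|].
  destruct (finite_lower_bound (fun n => Cmod (RtoC 1 - z * RtoC (p ^ n))%C) N)
    as [m [Hm Hn]].
  { intros n. apply Cmod_gt0. intros E. apply (Hz n).
    transitivity (RtoC 1 - (RtoC 1 - z * RtoC (p ^ n)))%C; [ring | rewrite E; ring]. }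
  exists (Rmin m (1/2)). split; [apply Rmin_glb_lt; lra|].
  intros n. destruct (Nat.lt_ge_cases n N) as [L|L].
  - eapply Rle_trans; [apply Rmin_l | now apply Hn].
  - eapply Rle_trans; [apply Rmin_r|].
    destruct (pow_le1 p n) as [H1 H2]; [lra|].
    assert (H3 := HN n L). rewrite Rabs_pos_eq in H3 by lra.
    assert (H4 : (Cmod z + 1) * p ^ n <= 1 / 2).
    { apply Rlt_le in H3.
      apply (Rmult_le_compat_l (Cmod z + 1)) in H3; [|lra].
      eapply Rle_trans; [exact H3|]. right. field. lra. }
    assert (H5 := Cmod_triangle (RtoC 1 - z * RtoC (p ^ n))%C (z * RtoC (p ^ n))%C).
    replace (RtoC 1 - z * RtoC (p ^ n) + z * RtoC (p ^ n))%C with (RtoC 1) in H5 by ring.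
    rewrite Cmod_mul, !Cmod_RtoC_pos in H5 by lra. nra.
Qed.

(** With y = |1 - z p^n| >= m > 0, the triangle inequality 1 <= y + |z| p^n gives 1/y <= 1 + (|z|/m)
    p^n, so the reciprocals satisfy the same Gronwall recursion with c = |z|/m. *)
Lemma qpoch_inv_bounded (p : R) (z : Cplx) :
  0 < p < 1 -> q_regular p z ->
  exists M, 0 < M /\ forall n, Cmod (Cinv (qpoch p z n)) <= M.
Proof.
  intros Hp Hz. assert (Z := Cmod_ge0 z).
  destruct (q_factor_lower_bound p z Hp Hz) as [m [Hm Hn]].
  assert (K := le_exp_of_geom_steps (fun n => Cmod (Cinv (qpoch p z n))) (Cmod z / m) p).
  exists (Cmod (Cinv (qpoch p z 0)) * exp (Cmod z / m / (1 - p))). split.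
  - apply Rmult_lt_0_compat; [|apply exp_pos].
    apply Cmod_gt0, Cinv_neq0, qpoch_neq0, Hz.
  - apply K; [apply Rle_mult_inv_pos; lra | lra | intros; apply Cmod_ge0 |].
    intros n. rewrite !Cmod_inv by now apply qpoch_neq0.
    rewrite qpoch_S, Cmod_mul, Rinv_mult.
    apply Rmult_le_compat_l.
    { apply Rlt_le, Rinv_0_lt_compat, Cmod_gt0, qpoch_neq0, Hz. }
    specialize (Hn n). set (y := Cmod (RtoC 1 - z * RtoC (p ^ n))%C) in *.
    destruct (pow_le1 p n) as [H1 H2]; [lra|].
    assert (H5 := Cmod_triangle (RtoC 1 - z * RtoC (p ^ n))%C (z * RtoC (p ^ n))%C).
    replace (RtoC 1 - z * RtoC (p ^ n) + z * RtoC (p ^ n))%C with (RtoC 1) in H5 by ring.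
    rewrite Cmod_mul, !Cmod_RtoC_pos in H5 by lra. fold y in H5.
    apply (Rmult_le_reg_l y); [lra|]. rewrite Rinv_r by lra.
    assert (H6 : Cmod z * p ^ n <= y * (Cmod z / m * p ^ n)).
    { replace (y * (Cmod z / m * p ^ n)) with ((y / m) * (Cmod z * p ^ n)) by (field; lra).
      assert (1 <= y / m).
      { apply (Rmult_le_reg_r m); [lra|]. unfold Rdiv.
        rewrite Rmult_assoc, Rinv_l; lra. }
      assert (0 <= Cmod z * p ^ n) by (apply Rmult_le_pos; lra). nra. }
    lra.
Qed.

Lemma qpoch_cv (p : R) (z : Cplx) :
  0 < p < 1 -> Cseq_cv (qpoch p z) (qpoch_inf z p).
Proof.
  intros Hp. apply Clim_cv.
  apply (Cseq_cv_of_geom_steps _ (exp (Cmod z / (1 - p)) * Cmod z) p); [lra|].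
  intros n. fold (qpoch p z n). fold (qpoch p z (S n)). rewrite qpoch_S.
  replace (qpoch p z n * (RtoC 1 - z * RtoC (p ^ n)) - qpoch p z n)%C
    with (- (qpoch p z n * z * RtoC (p ^ n)))%C by ring.
  destruct (pow_le1 p n) as [H1 H2]; [lra|].
  rewrite Cmod_opp, !Cmod_mul, Cmod_RtoC_pos by lra.
  apply Rmult_le_compat_r; [lra|].
  apply Rmult_le_compat_r; [apply Cmod_ge0|]. now apply qpoch_le.
Qed.

(** A zero limit would make the reciprocals of the partial products unbounded. *)
Lemma qpoch_inf_neq0 (p : R) (z : Cplx) :
  0 < p < 1 -> q_regular p z -> qpoch_inf z p <> RtoC 0.
Proof.
  intros Hp Hz E. assert (H := qpoch_cv p z Hp). rewrite E in H.
  destruct (qpoch_inv_bounded p z Hp Hz) as [M [HM Hn]].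
  destruct (H (/ M)) as [N HN]; [now apply Rinv_0_lt_compat|].
  specialize (HN N (le_n N)). specialize (Hn N).
  replace (qpoch p z N - RtoC 0)%C with (qpoch p z N) in HN by ring.
  rewrite Cmod_inv in Hn by now apply qpoch_neq0.
  assert (P := Cmod_gt0 _ (qpoch_neq0 p z N Hz)).
  apply Rinv_lt_contravar in HN.
  - rewrite Rinv_inv in HN. lra.
  - apply Rmult_lt_0_compat; [lra | now apply Rinv_0_lt_compat].
Qed.

Lemma qpoch_inf_split (p : R) (z : Cplx) (k : nat) :
  0 < p < 1 -> qpoch_inf z p = (qpoch p z k * qpoch_inf (z * RtoC (p ^ k)) p)%C.
Proof.
  intros Hp. apply (Cseq_cv_unique (fun n => qpoch p z (k + n))).
  - assert (H := qpoch_cv p z Hp). intros e He. destruct (H e He) as [N HN].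
    exists N. intros n Hn. apply HN. lia.
  - apply (Cseq_cv_ext (fun n => qpoch p z k * qpoch p (z * RtoC (p ^ k)) n)%C).
    + intros n. now rewrite qpoch_add.
    + apply Cseq_cv_mul; [apply Cseq_cv_const | now apply qpoch_cv].
Qed.

(** * The nonterminating very-well-poised 6phi5 sum *)

Definition cpow (z : Cplx) (n : nat) : Cplx := Cprod n (fun _ => z).

Lemma Cmod_cpow (z : Cplx) (n : nat) : Cmod (cpow z n) = Cmod z ^ n.
Proof.
  induction n as [|n IH].
  - apply Cmod_RtoC_pos. lra.
  - change (cpow z (S n)) with (cpow z n * z)%C. rewrite Cmod_mul, IH. simpl. ring.
Qed.

Lemma cpow_mul (y z : Cplx) (n : nat) : cpow (y * z)%C n = (cpow y n * cpow z n)%C.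
Proof.
  induction n as [|n IH].
  - unfold cpow; simpl. ring.
  - change (cpow (y * z)%C (S n)) with (cpow (y * z)%C n * (y * z))%C.
    change (cpow y (S n)) with (cpow y n * y)%C.
    change (cpow z (S n)) with (cpow z n * z)%C. rewrite IH. ring.
Qed.

Lemma cpow_RtoC (x : R) (n : nat) : cpow (RtoC x) n = RtoC (x ^ n).
Proof.
  induction n as [|n IH]; [reflexivity|].
  change (cpow (RtoC x) (S n)) with (cpow (RtoC x) n * RtoC x)%C.
  rewrite IH, <- RtoC_mul. f_equal. simpl. ring.
Qed.

Definition wp_arg (p : R) (A B C D : Cplx) : Cplx := (RtoC p * A / (B * C * D))%C.

(** The 6phi5 summand stripped of its very-well-poised factor. What remains has simple ratios both
    in n and under A -> pA, which is all that the telescoping uses. *)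
Definition wp_coef (p : R) (A B C D : Cplx) (n : nat) : Cplx :=
  (qpoch p A n * qpoch p B n * qpoch p C n * qpoch p D n
   / (qpoch p (RtoC p) n * qpoch p (RtoC p * A / B) n
      * qpoch p (RtoC p * A / C) n * qpoch p (RtoC p * A / D) n)
   * cpow (wp_arg p A B C D) n)%C.

(** The customary factor (1 - A p^(2n)) / (1 - A) appears without its denominator, so no value of A
    is excluded by a division. *)
Definition wp_term (p : R) (A B C D : Cplx) (n : nat) : Cplx :=
  ((RtoC 1 - A * RtoC (p ^ n) * RtoC (p ^ n)) * wp_coef p A B C D n)%C.

Definition wp_regular (p : R) (A B C D : Cplx) : Prop :=
  B <> RtoC 0 /\ C <> RtoC 0 /\ D <> RtoC 0 /\
  q_regular p (RtoC p * A / B)%C /\ q_regular p (RtoC p * A / C)%C /\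
  q_regular p (RtoC p * A / D)%C /\ Cmod (wp_arg p A B C D) < 1.

(** [wp_num] over [wp_den] at n is the ratio R(A) / R(p^n A), written with finite products; as n
    grows it tends to R(A). *)
Definition wp_num (p : R) (A B C D : Cplx) (n : nat) : Cplx :=
  (qpoch p A n * qpoch p (RtoC p * A / (B * C)) n
   * qpoch p (RtoC p * A / (B * D)) n * qpoch p (RtoC p * A / (C * D)) n)%C.

Definition wp_den (p : R) (A B C D : Cplx) (n : nat) : Cplx :=
  (qpoch p (RtoC p * A / B) n * qpoch p (RtoC p * A / C) n
   * qpoch p (RtoC p * A / D) n * qpoch p (wp_arg p A B C D) n)%C.

Lemma wp_regular_shift (p : R) (A B C D : Cplx) (k : nat) :
  0 < p < 1 -> wp_regular p A B C D -> wp_regular p (A * RtoC (p ^ k))%C B C D.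
Proof.
  intros Hp (HB & HC & HD & H1 & H2 & H3 & Hz).
  assert (E : forall X, X <> RtoC 0 -> (RtoC p * (A * RtoC (p ^ k)) / X
    = RtoC p * A / X * RtoC (p ^ k))%C) by (intros X HX; field; exact HX).
  repeat split; trivial; unfold wp_arg in *;
    try (rewrite E by trivial; now apply q_regular_shift).
  rewrite E by (repeat apply Cmul_neq0; trivial).
  destruct (pow_le1 p k) as [K1 K2]; [lra|].
  rewrite Cmod_mul, Cmod_RtoC_pos by lra.
  assert (K := Cmod_ge0 (RtoC p * A / (B * C * D))%C). nra.
Qed.

Lemma q_regular_self (p : R) : 0 < p < 1 -> q_regular p (RtoC p).
Proof. intros Hp. apply q_regular_small; [exact Hp | rewrite Cmod_RtoC_pos; lra]. Qed.

Lemma one_sub_neq0 (z : Cplx) : z <> RtoC 1 -> (RtoC 1 - z)%C <> RtoC 0.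
Proof.
  intros H E. apply H. transitivity (RtoC 1 - (RtoC 1 - z))%C; [ring | rewrite E; ring].
Qed.

Lemma q_regular_one_sub (p : R) (z : Cplx) (n : nat) :
  q_regular p z -> (RtoC 1 - z * RtoC (p ^ n))%C <> RtoC 0.
Proof. intros H. apply one_sub_neq0, H. Qed.

(** Both sides are (z; p)_(n+1), with the first or the last factor split off. *)
Lemma qpoch_shift1 (p : R) (z : Cplx) (n : nat) :
  ((RtoC 1 - z) * qpoch p (z * RtoC p) n)%C
  = (qpoch p z n * (RtoC 1 - z * RtoC (p ^ n)))%C.
Proof.
  rewrite <- qpoch_S. change (S n) with (1 + n)%nat. rewrite qpoch_add.
  unfold qpoch at 2. simpl. rewrite Rmult_1_r. ring.
Qed.

Lemma q_regular_one_sub0 (p : R) (z : Cplx) :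
  q_regular p z -> (RtoC 1 - z)%C <> RtoC 0.
Proof.
  intros H. replace z with (z * RtoC (p ^ 0))%C; [now apply q_regular_one_sub|].
  simpl. ring.
Qed.

Lemma qpoch_shift1_regular (p : R) (z : Cplx) (n : nat) :
  q_regular p z ->
  qpoch p (z * RtoC p)%C n
  = (qpoch p z n * (RtoC 1 - z * RtoC (p ^ n)) / (RtoC 1 - z))%C.
Proof.
  intros H. rewrite <- qpoch_shift1. field. now apply (q_regular_one_sub0 p).
Qed.

Lemma wp_coef_S (p : R) (A B C D : Cplx) (n : nat) :
  0 < p < 1 -> wp_regular p A B C D ->
  let x := RtoC (p ^ n) in let P := RtoC p in
  wp_coef p A B C D (S n) =
  (wp_coef p A B C D n *
   ((RtoC 1 - A * x) * (RtoC 1 - B * x) * (RtoC 1 - C * x) * (RtoC 1 - D * x)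
    / ((RtoC 1 - P * x) * (RtoC 1 - P * A / B * x)
       * (RtoC 1 - P * A / C * x) * (RtoC 1 - P * A / D * x))
    * wp_arg p A B C D))%C.
Proof.
  intros Hp (HB & HC & HD & H1 & H2 & H3 & Hz) x P. unfold wp_coef.
  change (cpow (wp_arg p A B C D) (S n))
    with (cpow (wp_arg p A B C D) n * wp_arg p A B C D)%C.
  rewrite !qpoch_S. fold x. fold P.
  assert (K0 := q_regular_self p Hp).
  assert (N0 := qpoch_neq0 _ _ n K0). assert (N1 := qpoch_neq0 _ _ n H1).
  assert (N2 := qpoch_neq0 _ _ n H2). assert (N3 := qpoch_neq0 _ _ n H3).
  assert (M0 := q_regular_one_sub _ _ n K0). assert (M1 := q_regular_one_sub _ _ n H1).
  assert (M2 := q_regular_one_sub _ _ n H2). assert (M3 := q_regular_one_sub _ _ n H3).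
  fold x P in M0, M1, M2, M3, N0, N1, N2, N3.
  (* Making the denominators opaque keeps [field] from opening the quotients inside them: its side
     conditions are then exactly the nonvanishing facts at hand. *)
  set (d1 := (RtoC 1 - P * A / B * x)%C) in *.
  set (d2 := (RtoC 1 - P * A / C * x)%C) in *.
  set (d3 := (RtoC 1 - P * A / D * x)%C) in *.
  generalize dependent (qpoch p (P * A / B)%C n).
  generalize dependent (qpoch p (P * A / C)%C n).
  generalize dependent (qpoch p (P * A / D)%C n). intros.
  field. repeat split; assumption.
Qed.

(** Each shifted product changes by one boundary quotient, and the argument contributes the final
    p^n. The factor 1 - A stays on the left because A may equal 1. *)
Lemma wp_coef_shift (p : R) (A B C D : Cplx) (n : nat) :
  0 < p < 1 -> wp_regular p A B C D ->
  let x := RtoC (p ^ n) in let P := RtoC p in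
  ((RtoC 1 - A) * wp_coef p (A * P) B C D n =
   wp_coef p A B C D n *
   ((RtoC 1 - A * x) * (RtoC 1 - P * A / B) * (RtoC 1 - P * A / C) * (RtoC 1 - P * A / D)
    / ((RtoC 1 - P * A / B * x) * (RtoC 1 - P * A / C * x) * (RtoC 1 - P * A / D * x))
    * x))%C.
Proof.
  intros Hp (HB & HC & HD & H1 & H2 & H3 & Hz) x P. unfold wp_coef.
  assert (E : forall X, X <> RtoC 0 -> (P * (A * P) / X = P * A / X * P)%C)
    by (intros X HX; field; exact HX).
  assert (Ez : wp_arg p (A * P)%C B C D = (wp_arg p A B C D * P)%C)
    by (apply E; repeat apply Cmul_neq0; trivial).
  fold P. rewrite Ez, !E by trivial.
  rewrite (qpoch_shift1_regular p (P * A / B)%C), (qpoch_shift1_regular p (P * A / C)%C),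
    (qpoch_shift1_regular p (P * A / D)%C) by trivial.
  rewrite cpow_mul. replace (cpow P n) with x by (symmetry; apply cpow_RtoC). fold x.
  assert (EA := qpoch_shift1 p A n). fold P x in EA.
  assert (K0 := q_regular_self p Hp).
  assert (N0 := qpoch_neq0 _ _ n K0). assert (N1 := qpoch_neq0 _ _ n H1).
  assert (N2 := qpoch_neq0 _ _ n H2). assert (N3 := qpoch_neq0 _ _ n H3).
  assert (M1 := q_regular_one_sub _ _ n H1).
  assert (M2 := q_regular_one_sub _ _ n H2). assert (M3 := q_regular_one_sub _ _ n H3).
  assert (L1 := q_regular_one_sub0 _ _ H1).
  assert (L2 := q_regular_one_sub0 _ _ H2). assert (L3 := q_regular_one_sub0 _ _ H3).
  fold x P in M1, M2, M3, N0, N1, N2, N3, L1, L2, L3.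
  set (d1 := (RtoC 1 - P * A / B * x)%C) in *.
  set (d2 := (RtoC 1 - P * A / C * x)%C) in *.
  set (d3 := (RtoC 1 - P * A / D * x)%C) in *.
  set (e1 := (RtoC 1 - P * A / B)%C) in *.
  set (e2 := (RtoC 1 - P * A / C)%C) in *.
  set (e3 := (RtoC 1 - P * A / D)%C) in *.
  generalize dependent (qpoch p (P * A / B)%C n).
  generalize dependent (qpoch p (P * A / C)%C n).
  generalize dependent (qpoch p (P * A / D)%C n). intros q3 N3 q2 N2 q1 N1.
  generalize dependent (qpoch p (A * P)%C n). intros a EA.
  transitivity (((RtoC 1 - A) * a) * (qpoch p B n * qpoch p C n * qpoch p D n
    / (qpoch p P n * (q1 * d1 / e1) * (q2 * d2 / e2) * (q3 * d3 / e3))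
    * (cpow (wp_arg p A B C D) n * x)))%C; [unfold Cdiv; ring|].
  rewrite EA. field. repeat split; assumption.
Qed.

(* Found by q-Gosper summation: the first difference of wp_cert is
   wp_term A - rho * wp_term (A p), with rho the ratio of the product sides. *)
Definition wp_cert (p : R) (A B C D : Cplx) (n : nat) : Cplx :=
  let x := RtoC (p ^ n) in
  let z := wp_arg p A B C D in
  ((RtoC 1 - x) * (A * z * x - RtoC 1) / (RtoC 1 - z) * wp_coef p A B C D n)%C.

Lemma wp_arg_regular (p : R) (A B C D : Cplx) :
  0 < p < 1 -> wp_regular p A B C D -> q_regular p (wp_arg p A B C D).
Proof.
  intros Hp (HB & HC & HD & H1 & H2 & H3 & Hz). now apply q_regular_small.
Qed.

(** All terms are rational multiples of the one coefficient u = [wp_coef p A B C D n], so the claim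
    reduces to a rational identity in p, A, B, C, D and x = p^n. *)
Lemma wp_term_telescope (p : R) (A B C D : Cplx) (n : nat) :
  0 < p < 1 -> wp_regular p A B C D ->
  (wp_term p A B C D n + wp_cert p A B C D n
   = wp_num p A B C D 1 / wp_den p A B C D 1 * wp_term p (A * RtoC p) B C D n
     + wp_cert p A B C D (S n))%C.
Proof.
  intros Hp Hr. assert (HS := wp_coef_S p A B C D n Hp Hr).
  assert (HT := wp_coef_shift p A B C D n Hp Hr).
  assert (K := wp_arg_regular p A B C D Hp Hr).
  destruct Hr as (HB & HC & HD & H1 & H2 & H3 & Hz).
  assert (N0 := q_regular_one_sub0 _ _ K).
  assert (M0 := q_regular_one_sub _ _ n (q_regular_self p Hp)).
  assert (M1 := q_regular_one_sub _ _ n H1).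
  assert (M2 := q_regular_one_sub _ _ n H2). assert (M3 := q_regular_one_sub _ _ n H3).
  assert (L1 := q_regular_one_sub0 _ _ H1).
  assert (L2 := q_regular_one_sub0 _ _ H2). assert (L3 := q_regular_one_sub0 _ _ H3).
  unfold wp_term, wp_cert, wp_num, wp_den. rewrite HS.
  unfold qpoch. simpl Cprod. simpl pow. rewrite RtoC_mul. cbv zeta in HT.
  set (P := RtoC p) in *. set (x := RtoC (p ^ n)) in *.
  set (u := wp_coef p A B C D n) in *. clear HS.
  (* A multiple of [HT], that is of zero, is added to the right side. It cancels the shifted
     coefficient, which occurs there only multiplied by 1 - A, so no division by 1 - A arises and
     that coefficient can be generalised. *)
  match goal with |- _ = ?rhs =>
  transitivity (rhs + (RtoC 1 - P * A / (B * C)) * (RtoC 1 - P * A / (B * D))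
    * (RtoC 1 - P * A / (C * D)) / ((RtoC 1 - P * A / B) * (RtoC 1 - P * A / C)
      * (RtoC 1 - P * A / D) * (RtoC 1 - wp_arg p A B C D))
    * (RtoC 1 - A * P * x * x)
    * (u * ((RtoC 1 - A * x) * (RtoC 1 - P * A / B) * (RtoC 1 - P * A / C)
       * (RtoC 1 - P * A / D) / ((RtoC 1 - P * A / B * x) * (RtoC 1 - P * A / C * x)
       * (RtoC 1 - P * A / D * x)) * x)
       - (RtoC 1 - A) * wp_coef p (A * P) B C D n))%C end.
  2: { rewrite HT. unfold Cdiv. ring. }
  (* Here [field] must open the inner quotients, and it then asks for X - pA and X - pAx to be
     nonzero instead of 1 - pA/X and 1 - pAx/X. *)
  assert (W : forall X, X <> RtoC 0 -> (RtoC 1 - P * A / X)%C <> RtoC 0 ->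
    (X - P * A)%C <> RtoC 0).
  { intros X HX HN E. apply HN. transitivity ((X - P * A) / X)%C;
    [field; exact HX | rewrite E; field; exact HX]. }
  assert (W2 : forall X, X <> RtoC 0 -> (RtoC 1 - P * A / X * x)%C <> RtoC 0 ->
    (X - P * A * x)%C <> RtoC 0).
  { intros X HX HN E. apply HN. transitivity ((X - P * A * x) / X)%C;
    [field; exact HX | rewrite E; field; exact HX]. }
  apply W in N0; [|repeat apply Cmul_neq0; trivial].
  apply W in L1, L2, L3; trivial. apply W2 in M1, M2, M3; trivial.
  unfold wp_arg. fold P. generalize (wp_coef p (A * P)%C B C D n). intros v.
  field.
  repeat split; trivial.
Qed.

(** * Bounds uniform in the shift A -> p^k A, and evaluation of the sum *)

Lemma qpoch_shift_bounded (p : R) (z : Cplx) :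
  0 < p < 1 ->
  exists M, 0 < M /\ forall k n, Cmod (qpoch p (z * RtoC (p ^ k))%C n) <= M.
Proof.
  intros Hp. exists (exp (Cmod z / (1 - p))). split; [apply exp_pos|].
  intros k n. eapply Rle_trans; [now apply qpoch_le|].
  destruct (pow_le1 p k) as [H1 H2]; [lra|].
  rewrite Cmod_mul, Cmod_RtoC_pos by lra.
  assert (E : Cmod z * p ^ k / (1 - p) <= Cmod z / (1 - p)).
  { apply Rmult_le_compat_r; [apply Rlt_le, Rinv_0_lt_compat; lra|].
    assert (K := Cmod_ge0 z). nra. }
  destruct E as [E|E]; [left; now apply exp_increasing | right; now rewrite E].
Qed.

Lemma qpoch_inv_shift_bounded (p : R) (z : Cplx) :
  0 < p < 1 -> q_regular p z ->
  exists M, 0 < M /\ forall k n, Cmod (Cinv (qpoch p (z * RtoC (p ^ k))%C n)) <= M.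
Proof.
  intros Hp Hz. destruct (qpoch_inv_bounded p z Hp Hz) as [M [HM H]].
  exists (exp (Cmod z / (1 - p)) * M). split.
  - apply Rmult_lt_0_compat; [apply exp_pos | exact HM].
  - intros k n.
    replace (Cinv (qpoch p (z * RtoC (p ^ k))%C n))
      with (qpoch p z k * Cinv (qpoch p z (k + n)))%C.
    + rewrite Cmod_mul.
      apply Rmult_le_compat; try apply Cmod_ge0; [now apply qpoch_le | apply H].
    + rewrite qpoch_add. field. split; apply qpoch_neq0; trivial.
      now apply q_regular_shift.
Qed.

Lemma wp_arg_shift (p : R) (A B C D : Cplx) (k : nat) :
  B <> RtoC 0 -> C <> RtoC 0 -> D <> RtoC 0 ->
  wp_arg p (A * RtoC (p ^ k))%C B C D = (wp_arg p A B C D * RtoC (p ^ k))%C.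
Proof. intros HB HC HD. unfold wp_arg. field. auto. Qed.

(** The constant is independent of k, while p^k enters the base of the n-th power: k = 0 gives
    convergence of the series, and large k suppresses every term with n >= 1. *)
Lemma wp_coef_bound (p : R) (A B C D : Cplx) :
  0 < p < 1 -> wp_regular p A B C D ->
  exists K, 0 < K /\ forall k n,
    Cmod (wp_coef p (A * RtoC (p ^ k))%C B C D n)
    <= K * (Cmod (wp_arg p A B C D) * p ^ k) ^ n.
Proof.
  intros Hp (HB & HC & HD & H1 & H2 & H3 & Hz).
  destruct (qpoch_shift_bounded p A Hp) as [a [Ha Ka]].
  destruct (qpoch_shift_bounded p B Hp) as [b [Hb Kb]].
  destruct (qpoch_shift_bounded p C Hp) as [c [Hc Kc]].
  destruct (qpoch_shift_bounded p D Hp) as [d [Hd Kd]].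
  destruct (qpoch_inv_bounded p (RtoC p) Hp (q_regular_self p Hp)) as [m0 [Hm0 L0]].
  destruct (qpoch_inv_shift_bounded p _ Hp H1) as [m1 [Hm1 L1]].
  destruct (qpoch_inv_shift_bounded p _ Hp H2) as [m2 [Hm2 L2]].
  destruct (qpoch_inv_shift_bounded p _ Hp H3) as [m3 [Hm3 L3]].
  exists (a * b * c * d * (m0 * m1 * m2 * m3)).
  split; [repeat apply Rmult_lt_0_compat; trivial|].
  intros k n. unfold wp_coef.
  assert (E : forall X, X <> RtoC 0 -> (RtoC p * (A * RtoC (p ^ k)) / X
    = RtoC p * A / X * RtoC (p ^ k))%C) by (intros X HX; field; exact HX).
  rewrite wp_arg_shift, !E by trivial.
  destruct (pow_le1 p k) as [K1 K2]; [lra|].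
  rewrite Cmod_mul, Cmod_cpow, Cmod_mul, Cmod_RtoC_pos by lra.
  apply Rmult_le_compat_r.
  { apply pow_le. apply Rmult_le_pos; [apply Cmod_ge0 | lra]. }
  specialize (Ka k n). specialize (L0 n). specialize (L1 k n).
  specialize (L2 k n). specialize (L3 k n).
  assert (Kb0 := Kb 0%nat n). assert (Kc0 := Kc 0%nat n). assert (Kd0 := Kd 0%nat n).
  simpl in Kb0, Kc0, Kd0.
  replace (B * RtoC 1)%C with B in Kb0 by ring.
  replace (C * RtoC 1)%C with C in Kc0 by ring.
  replace (D * RtoC 1)%C with D in Kd0 by ring.
  assert (N0 := qpoch_neq0 _ _ n (q_regular_self p Hp)).
  assert (N1 := qpoch_neq0 _ _ n (q_regular_shift _ _ k H1)).
  assert (N2 := qpoch_neq0 _ _ n (q_regular_shift _ _ k H2)).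
  assert (N3 := qpoch_neq0 _ _ n (q_regular_shift _ _ k H3)).
  unfold Cdiv at 1.
  match goal with |- Cmod (?u * Cinv (?y0 * ?y1 * ?y2 * ?y3))%C <= _ =>
    replace (Cinv (y0 * y1 * y2 * y3))%C
      with (Cinv y0 * Cinv y1 * Cinv y2 * Cinv y3)%C by (field; auto) end.
  rewrite !Cmod_mul.
  repeat apply Rmult_le_compat; trivial; repeat apply Rmult_le_pos; apply Cmod_ge0.
Qed.

Lemma wp_term_bound (p : R) (A B C D : Cplx) :
  0 < p < 1 -> wp_regular p A B C D ->
  exists K, 0 < K /\ forall k n,
    Cmod (wp_term p (A * RtoC (p ^ k))%C B C D n)
    <= K * (Cmod (wp_arg p A B C D) * p ^ k) ^ n.
Proof.
  intros Hp Hr. destruct (wp_coef_bound p A B C D Hp Hr) as [K [HK H]].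
  assert (Z := Cmod_ge0 A).
  exists ((1 + Cmod A) * K). split; [apply Rmult_lt_0_compat; lra|].
  intros k n. unfold wp_term. rewrite Cmod_mul, Rmult_assoc.
  apply Rmult_le_compat; try apply Cmod_ge0; [|apply H].
  eapply Rle_trans; [apply Cmod_triangle|].
  destruct (pow_le1 p k) as [K1 K2]; [lra|].
  destruct (pow_le1 p n) as [K3 K4]; [lra|].
  rewrite Cmod_opp, !Cmod_mul, !Cmod_RtoC_pos by lra.
  apply Rplus_le_compat_l.
  rewrite !Rmult_assoc. rewrite <- (Rmult_1_r (Cmod A)) at 2.
  apply Rmult_le_compat_l; nra.
Qed.

Lemma Csum_wp_recurrence (p : R) (A B C D : Cplx) (N : nat) :
  0 < p < 1 -> wp_regular p A B C D ->
  Csum N (wp_term p A B C D)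
  = (wp_num p A B C D 1 / wp_den p A B C D 1 * Csum N (wp_term p (A * RtoC p)%C B C D)
     + wp_cert p A B C D N)%C.
Proof.
  intros Hp Hr. induction N as [|N IH].
  - unfold wp_cert. simpl. unfold Cdiv. ring.
  - simpl Csum. rewrite IH.
    match goal with |- (?s + ?g + ?t)%C = _ =>
      transitivity (s + (t + g))%C; [ring|] end.
    rewrite wp_term_telescope by trivial. ring.
Qed.

Lemma wp_cert_cv (p : R) (A B C D : Cplx) :
  0 < p < 1 -> wp_regular p A B C D -> Cseq_cv (wp_cert p A B C D) (RtoC 0).
Proof.
  intros Hp Hr. destruct (wp_coef_bound p A B C D Hp Hr) as [K [HK H]].
  assert (Hz : 0 <= Cmod (wp_arg p A B C D) < 1).
  { split; [apply Cmod_ge0 | apply Hr]. }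
  set (z := wp_arg p A B C D) in *.
  (* The factor 2 bounds |1 - p^n|, the next one bounds |A z p^n - 1|, and K comes from the
     coefficient bound at k = 0. *)
  apply (Cseq_cv_geom _ _ (2 * (Cmod A * Cmod z + 1) * Cmod (Cinv (RtoC 1 - z)%C) * K)
    (Cmod z) Hz).
  intros n. replace (wp_cert p A B C D n - RtoC 0)%C with (wp_cert p A B C D n) by ring.
  unfold wp_cert, Cdiv. fold z. rewrite !Cmod_mul, (Rmult_assoc _ K).
  specialize (H 0%nat n). simpl in H. rewrite Rmult_1_r in H.
  replace (A * RtoC 1)%C with A in H by ring.
  apply Rmult_le_compat; trivial; try apply Cmod_ge0.
  { repeat apply Rmult_le_pos; apply Cmod_ge0. }
  apply Rmult_le_compat_r; [apply Cmod_ge0|].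
  destruct (pow_le1 p n) as [K3 K4]; [lra|].
  apply Rmult_le_compat; try apply Cmod_ge0; (eapply Rle_trans; [apply Cmod_triangle|]).
  - rewrite Cmod_opp, !Cmod_RtoC_pos by lra. lra.
  - rewrite Cmod_opp, !Cmod_mul, !Cmod_RtoC_pos by lra.
    apply Rplus_le_compat_r. rewrite <- (Rmult_1_r (Cmod A * Cmod z)) at 2.
    apply Rmult_le_compat_l; [apply Rmult_le_pos; apply Cmod_ge0 | lra].
Qed.

Lemma wp_summable (p : R) (A B C D : Cplx) :
  0 < p < 1 -> wp_regular p A B C D ->
  exists l, Cseq_cv (fun N => Csum N (wp_term p A B C D)) l.
Proof.
  intros Hp Hr. destruct (wp_term_bound p A B C D Hp Hr) as [K [HK H]].
  apply (Cseq_cv_of_geom_steps _ K (Cmod (wp_arg p A B C D))).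
  - split; [apply Cmod_ge0 | apply Hr].
  - intros n. simpl Csum. specialize (H 0%nat n). simpl in H. rewrite Rmult_1_r in H.
    replace (A * RtoC 1)%C with A in H by ring.
    match goal with |- Cmod (?s + ?t - ?s)%C <= _ =>
      replace (s + t - s)%C with t by ring end.
    exact H.
Qed.

Definition wp_sum (p : R) (A B C D : Cplx) : Cplx :=
  Clim (fun N => Csum N (wp_term p A B C D)).

Lemma wp_sum_cv (p : R) (A B C D : Cplx) :
  0 < p < 1 -> wp_regular p A B C D ->
  Cseq_cv (fun N => Csum N (wp_term p A B C D)) (wp_sum p A B C D).
Proof. intros Hp Hr. now apply Clim_cv, wp_summable. Qed.

Lemma wp_sum_recurrence (p : R) (A B C D : Cplx) :
  0 < p < 1 -> wp_regular p A B C D ->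
  wp_sum p A B C D
  = (wp_num p A B C D 1 / wp_den p A B C D 1 * wp_sum p (A * RtoC p)%C B C D)%C.
Proof.
  intros Hp Hr. apply (Cseq_cv_unique (fun N => Csum N (wp_term p A B C D))).
  - now apply wp_sum_cv.
  - match goal with |- Cseq_cv _ ?l => replace l with (l + RtoC 0)%C by ring end.
    eapply Cseq_cv_ext; [intros N; symmetry; now apply Csum_wp_recurrence|].
    apply Cseq_cv_add; [|now apply wp_cert_cv].
    apply Cseq_cv_mul; [apply Cseq_cv_const|]. apply wp_sum_cv; [exact Hp|].
    assert (H := wp_regular_shift p A B C D 1 Hp Hr).
    simpl in H. now rewrite Rmult_1_r in H.
Qed.

Lemma wp_den_neq0 (p : R) (A B C D : Cplx) (n : nat) :
  0 < p < 1 -> wp_regular p A B C D -> wp_den p A B C D n <> RtoC 0.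
Proof.
  intros Hp Hr. assert (K := wp_arg_regular p A B C D Hp Hr).
  destruct Hr as (HB & HC & HD & H1 & H2 & H3 & Hz).
  repeat apply Cmul_neq0; now apply qpoch_neq0.
Qed.

Lemma wp_sum_iterate (p : R) (A B C D : Cplx) (k : nat) :
  0 < p < 1 -> wp_regular p A B C D ->
  wp_sum p A B C D
  = (wp_num p A B C D k / wp_den p A B C D k
     * wp_sum p (A * RtoC (p ^ k))%C B C D)%C.
Proof.
  intros Hp Hr. induction k as [|k IH].
  - unfold wp_num, wp_den, qpoch. simpl. replace (A * RtoC 1)%C with A by ring.
    field. apply RtoC_neq0; lra.
  - rewrite IH. assert (Hk := wp_regular_shift p A B C D k Hp Hr).
    rewrite wp_sum_recurrence by trivial.
    replace (A * RtoC (p ^ S k))%C with (A * RtoC (p ^ k) * RtoC p)%C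
      by (simpl; rewrite RtoC_mul; ring).
    assert (Dk := wp_den_neq0 p A B C D k Hp Hr).
    assert (D1 := wp_den_neq0 p _ B C D 1 Hp Hk).
    (* Cocycle property: the ratio for k + 1 shifts is the ratio for k shifts times the one-step
       ratio at p^k A. *)
    replace (wp_num p A B C D (S k))
      with (wp_num p A B C D k * wp_num p (A * RtoC (p ^ k))%C B C D 1)%C.
    replace (wp_den p A B C D (S k))
      with (wp_den p A B C D k * wp_den p (A * RtoC (p ^ k))%C B C D 1)%C.
    + field. auto.
    + destruct Hr as (HB & HC & HD & _).
      replace (S k) with (k + 1)%nat by lia. unfold wp_den.
      rewrite !qpoch_add, wp_arg_shift by trivial.
      assert (E : forall X, X <> RtoC 0 -> (RtoC p * (A * RtoC (p ^ k)) / X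
        = RtoC p * A / X * RtoC (p ^ k))%C) by (intros X HX; field; exact HX).
      rewrite !E by trivial. ring.
    + destruct Hr as (HB & HC & HD & _).
      replace (S k) with (k + 1)%nat by lia. unfold wp_num. rewrite !qpoch_add.
      assert (E : forall X, X <> RtoC 0 -> (RtoC p * (A * RtoC (p ^ k)) / X
        = RtoC p * A / X * RtoC (p ^ k))%C) by (intros X HX; field; exact HX).
      rewrite !E by now apply Cmul_neq0. ring.
Qed.

Lemma Cseq_cv_Cmod_le (u : nat -> Cplx) (l c : Cplx) (M : R) :
  Cseq_cv u l -> (forall n, Cmod (u n - c)%C <= M) -> Cmod (l - c)%C <= M.
Proof.
  intros H HM. destruct (Rle_lt_dec (Cmod (l - c)%C) M) as [|L]; [assumption|].
  destruct (H (Cmod (l - c)%C - M)) as [N HN]; [lra|].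
  specialize (HN N (le_n N)). specialize (HM N).
  assert (T := Cmod_triangle (l - u N)%C (u N - c)%C).
  replace (l - u N + (u N - c))%C with (l - c)%C in T by ring.
  rewrite (Cmod_sub_sym l (u N)) in T. lra.
Qed.

(** The zeroth term is 1 - A p^k. For n >= 1 the n-th term is at most K (r p^k)^n <= K p^k r^(n-1),
    so the tail is at most p^k K / (1 - r). *)
Lemma wp_sum_shift_cv (p : R) (A B C D : Cplx) :
  0 < p < 1 -> wp_regular p A B C D ->
  Cseq_cv (fun k => wp_sum p (A * RtoC (p ^ k))%C B C D) (RtoC 1).
Proof.
  intros Hp Hr. destruct (wp_term_bound p A B C D Hp Hr) as [K [HK H]].
  assert (Hz : 0 <= Cmod (wp_arg p A B C D) < 1).
  { split; [apply Cmod_ge0 | apply Hr]. }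
  set (r := Cmod (wp_arg p A B C D)) in *.
  apply (Cseq_cv_geom _ _ (K / (1 - r) + Cmod A) p); [lra|].
  intros k. set (s := wp_sum p (A * RtoC (p ^ k))%C B C D).
  destruct (pow_le1 p k) as [K1 K2]; [lra|].
  replace (s - RtoC 1)%C
    with ((s - (RtoC 1 - A * RtoC (p ^ k))) + - (A * RtoC (p ^ k)))%C by ring.
  eapply Rle_trans; [apply Cmod_triangle|].
  rewrite Cmod_opp, Cmod_mul, Cmod_RtoC_pos, Rmult_plus_distr_r by lra.
  apply Rplus_le_compat_r.
  assert (T0 : wp_term p (A * RtoC (p ^ k))%C B C D 0 = (RtoC 1 - A * RtoC (p ^ k))%C).
  { unfold wp_term, wp_coef, qpoch, cpow. simpl. field. apply RtoC_neq0; lra. }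
  (* Partial sums are taken up to S N so that the zeroth term is always present to be subtracted. *)
  apply (Cseq_cv_Cmod_le (fun N => Csum (S N) (wp_term p (A * RtoC (p ^ k))%C B C D))).
  { apply (Cseq_cv_incr (fun N => Csum N (wp_term p (A * RtoC (p ^ k))%C B C D))).
    apply wp_sum_cv; [exact Hp | now apply wp_regular_shift]. }
  intros N. rewrite <- T0.
  apply Rle_trans with (K * p ^ k * ((1 - r ^ N) / (1 - r))).
  - induction N as [|N IH].
    + simpl. match goal with |- Cmod ?x <= _ => replace x with (RtoC 0) by ring end.
      rewrite Cmod_RtoC_pos by lra. right. field. lra.
    + set (T := wp_term p (A * RtoC (p ^ k))%C B C D) in *.
      change (Csum (S (S N)) T) with (Csum (S N) T + T (S N))%C.
      replace (Csum (S N) T + T (S N) - T O)%C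
        with (Csum (S N) T - T O + T (S N))%C by ring.
      eapply Rle_trans; [apply Cmod_triangle|].
      replace (K * p ^ k * ((1 - r ^ S N) / (1 - r)))
        with (K * p ^ k * ((1 - r ^ N) / (1 - r)) + K * (p ^ k * r ^ N))
        by (simpl; field; lra).
      apply Rplus_le_compat; [exact IH|].
      eapply Rle_trans; [apply H|]. apply Rmult_le_compat_l; [lra|].
      rewrite Rpow_mult_distr. simpl.
      destruct (pow_le1 r N) as [R1 R2]; [lra|].
      destruct (pow_le1 (p ^ k) N) as [R3 R4]; [lra|].
      assert (r * r ^ N <= r ^ N) by nra.
      assert (p ^ k * (p ^ k) ^ N <= p ^ k) by nra.
      rewrite (Rmult_comm (p ^ k) (r ^ N)).
      apply Rmult_le_compat; trivial; apply Rmult_le_pos; lra.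
  - destruct (pow_le1 r N) as [R1 R2]; [lra|].
    replace (K / (1 - r) * p ^ k) with (K * p ^ k * (1 / (1 - r))) by (field; lra).
    apply Rmult_le_compat_l; [apply Rmult_le_pos; lra|].
    apply Rmult_le_compat_r; [apply Rlt_le, Rinv_0_lt_compat; lra | lra].
Qed.

(** Rogers' nonterminating 6phi5 sum, multiplied by 1 - A. *)
Lemma wp_6phi5_sum (p : R) (A B C D : Cplx) :
  0 < p < 1 -> wp_regular p A B C D ->
  Cseq_cv (fun N => Csum N (wp_term p A B C D))
    (qpoch_inf A p * qpoch_inf (RtoC p * A / (B * C)) p
     * qpoch_inf (RtoC p * A / (B * D)) p * qpoch_inf (RtoC p * A / (C * D)) p
     / (qpoch_inf (RtoC p * A / B) p * qpoch_inf (RtoC p * A / C) p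
        * qpoch_inf (RtoC p * A / D) p * qpoch_inf (wp_arg p A B C D) p))%C.
Proof.
  intros Hp Hr.
  match goal with |- Cseq_cv _ ?l => replace l with (wp_sum p A B C D) end.
  { now apply wp_sum_cv. }
  apply (Cseq_cv_unique (fun _ => wp_sum p A B C D)); [apply Cseq_cv_const|].
  eapply Cseq_cv_ext; [intros k; symmetry; now apply (wp_sum_iterate p A B C D k)|].
  match goal with |- Cseq_cv _ ?l => replace l with (l * RtoC 1)%C by ring end.
  apply Cseq_cv_mul; [|now apply wp_sum_shift_cv].
  assert (K := wp_arg_regular p A B C D Hp Hr).
  destruct Hr as (HB & HC & HD & H1 & H2 & H3 & Hz).
  apply Cseq_cv_div.
  - repeat apply Cmul_neq0; now apply qpoch_inf_neq0.
  - repeat apply Cseq_cv_mul; now apply qpoch_cv.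
  - repeat apply Cseq_cv_mul; now apply qpoch_cv.
Qed.

(** * q-powers and the q^2-gamma function *)

Lemma Cexp_add (x y : Cplx) : Cexp (x + y)%C = (Cexp x * Cexp y)%C.
Proof.
  unfold Cexp, Cadd, Cmul. simpl. rewrite exp_plus, cos_plus, sin_plus.
  f_equal; ring.
Qed.

Lemma Cexp_0 : Cexp (RtoC 0) = RtoC 1.
Proof. unfold Cexp, RtoC. simpl. rewrite exp_0, cos_0, sin_0. f_equal; ring. Qed.

Lemma qpow_add (q : R) (x y : Cplx) : qpow q (x + y)%C = (qpow q x * qpow q y)%C.
Proof. unfold qpow. rewrite <- Cexp_add. f_equal. ring. Qed.

Lemma qpow_0 (q : R) : qpow q (RtoC 0) = RtoC 1.
Proof. unfold qpow. rewrite <- Cexp_0. f_equal. ring. Qed.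

Lemma qpow_neq0 (q : R) (x : Cplx) : qpow q x <> RtoC 0.
Proof.
  intros E. apply (RtoC_neq0 1); [lra|].
  rewrite <- (qpow_0 q). replace (RtoC 0) with (x + - x)%C at 1 by ring.
  rewrite qpow_add, E. ring.
Qed.

Lemma qpow_sub (q : R) (x y : Cplx) : qpow q (x - y)%C = (qpow q x / qpow q y)%C.
Proof.
  assert (H := qpow_neq0 q y). transitivity (qpow q (x - y) * qpow q y / qpow q y)%C.
  - field. exact H.
  - rewrite <- qpow_add. do 2 f_equal. ring.
Qed.

Lemma qpow_1 (q : R) : 0 < q -> qpow q (RtoC 1) = RtoC q.
Proof.
  intros Hq. unfold qpow. replace (RtoC 1 * RtoC (ln q))%C with (RtoC (ln q)) by ring.
  unfold Cexp, RtoC. simpl. rewrite exp_ln, cos_0, sin_0 by exact Hq. f_equal; ring.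
Qed.

Lemma RtoC_add (x y : R) : RtoC (x + y) = (RtoC x + RtoC y)%C.
Proof. apply Complex.RtoC_plus. Qed.

Lemma qpow_mul_nat (q : R) (x : Cplx) (n : nat) :
  qpow q (x * RtoC (INR n))%C = cpow (qpow q x) n.
Proof.
  induction n as [|n IH].
  - change (cpow (qpow q x) 0) with (RtoC 1). rewrite <- (qpow_0 q). f_equal. simpl. ring.
  - rewrite S_INR, RtoC_add.
    change (cpow (qpow q x) (S n)) with (cpow (qpow q x) n * qpow q x)%C.
    rewrite <- IH, <- qpow_add. f_equal. ring.
Qed.

Lemma qpow_nat (q : R) (n : nat) : 0 < q -> qpow q (RtoC (INR n)) = RtoC (q ^ n).
Proof.
  intros Hq. rewrite <- cpow_RtoC, <- (qpow_1 q Hq), <- qpow_mul_nat.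
  f_equal. ring.
Qed.

Lemma Cmod_qpow (q : R) (x : Cplx) : Cmod (qpow q x) = exp (Cre x * ln q).
Proof.
  unfold qpow, Cexp, Cmod, Cre. simpl fst. simpl snd.
  set (u := (fst x * ln q - snd x * 0)%R). set (v := (fst x * 0 + snd x * ln q)%R).
  replace ((exp u * cos v) ^ 2 + (exp u * sin v) ^ 2)
    with (exp u ^ 2 * (Rsqr (sin v) + Rsqr (cos v))) by (unfold Rsqr; ring).
  rewrite sin2_cos2, Rmult_1_r, sqrt_pow2 by (left; apply exp_pos).
  unfold u. f_equal. ring.
Qed.

Definition q2pow (q : R) (x : Cplx) : Cplx := qpow q (RtoC 2 * x)%C.

Lemma q2pow_add (q : R) (x y : Cplx) : q2pow q (x + y)%C = (q2pow q x * q2pow q y)%C.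
Proof. unfold q2pow. rewrite <- qpow_add. f_equal. ring. Qed.

Lemma q2pow_sub (q : R) (x y : Cplx) : q2pow q (x - y)%C = (q2pow q x / q2pow q y)%C.
Proof. unfold q2pow. rewrite <- qpow_sub. f_equal. ring. Qed.

Lemma q2pow_1 (q : R) : 0 < q -> q2pow q (RtoC 1) = RtoC (q ^ 2).
Proof.
  intros Hq. rewrite <- (qpow_nat q 2 Hq). unfold q2pow. f_equal. simpl INR.
  replace (1 + 1) with 2 by ring. ring.
Qed.

Lemma q2pow_nat (q : R) (n : nat) :
  0 < q -> q2pow q (RtoC (INR n)) = RtoC ((q ^ 2) ^ n).
Proof.
  intros Hq. unfold q2pow. rewrite qpow_mul_nat, <- cpow_RtoC. f_equal.
  rewrite <- (q2pow_1 q Hq). unfold q2pow. f_equal. ring.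
Qed.

Lemma q_regular_of_not_pole (q : R) (x : Cplx) :
  ~ qgamma2_pole q x -> q_regular (q ^ 2) (q2pow q x).
Proof. intros H k E. apply H. now exists k. Qed.

Lemma sqr_lt1 (q : R) : 0 < q -> q < 1 -> 0 < q ^ 2 < 1.
Proof. intros. simpl. nra. Qed.

(** The power of 1 - q^2 is itself a [qpow], with base 1 - q^2, so the exponent laws proved for base
    q apply to it. *)
Lemma qgamma2_eq (q : R) (x : Cplx) :
  qgamma2 q x = (qpoch_inf (RtoC (q ^ 2)) (q ^ 2) / qpoch_inf (q2pow q x) (q ^ 2)
                 * qpow (1 - q ^ 2) (RtoC 1 - x))%C.
Proof. reflexivity. Qed.

Lemma qgamma2_neq0 (q : R) (x : Cplx) :
  0 < q -> q < 1 -> ~ qgamma2_pole q x -> qgamma2 q x <> RtoC 0.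
Proof.
  intros H0 H1 Hx. assert (Hp := sqr_lt1 q H0 H1). rewrite qgamma2_eq.
  apply Cmul_neq0; [|apply qpow_neq0]. apply Cdiv_neq0; apply qpoch_inf_neq0; trivial.
  - now apply q_regular_self.
  - now apply q_regular_of_not_pole.
Qed.

Lemma qpoch_inf_qgamma2 (q : R) (x : Cplx) :
  0 < q -> q < 1 -> ~ qgamma2_pole q x ->
  qpoch_inf (q2pow q x) (q ^ 2)
  = (qpoch_inf (RtoC (q ^ 2)) (q ^ 2) * qpow (1 - q ^ 2) (RtoC 1 - x) / qgamma2 q x)%C.
Proof.
  intros H0 H1 Hx. assert (Hp := sqr_lt1 q H0 H1). rewrite qgamma2_eq.
  assert (N1 := qpow_neq0 (1 - q ^ 2) (RtoC 1 - x)%C).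
  assert (N2 := qpoch_inf_neq0 _ _ Hp (q_regular_self _ Hp)).
  assert (N3 := qpoch_inf_neq0 _ _ Hp (q_regular_of_not_pole _ _ Hx)).
  field. auto.
Qed.

(** Splitting n factors off the infinite product isolates the dependence on n in a finite
    product. *)
Lemma qgamma2_add_nat (q : R) (x : Cplx) (n : nat) :
  0 < q -> q < 1 -> ~ qgamma2_pole q x ->
  qgamma2 q (x + RtoC (INR n))%C
  = (qgamma2 q x * qpoch (q ^ 2) (q2pow q x) n / RtoC ((1 - q ^ 2) ^ n))%C.
Proof.
  intros H0 H1 Hx. assert (Hp := sqr_lt1 q H0 H1).
  assert (Hr := q_regular_of_not_pole _ _ Hx).
  rewrite !qgamma2_eq, q2pow_add, q2pow_nat by exact H0.
  rewrite (qpoch_inf_split _ (q2pow q x) n Hp).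
  assert (N2 := qpoch_neq0 _ _ n Hr).
  assert (N3 := qpoch_inf_neq0 _ _ Hp (q_regular_shift _ _ n Hr)).
  assert (N4 : RtoC ((1 - q ^ 2) ^ n) <> RtoC 0).
  { apply RtoC_neq0, pow_nonzero. lra. }
  replace (RtoC 1 - (x + RtoC (INR n)))%C with (RtoC 1 - x - RtoC (INR n))%C by ring.
  rewrite (qpow_sub _ (RtoC 1 - x)%C), (qpow_nat (1 - q ^ 2)) by lra. field. auto.
Qed.

Lemma qfact2_eq (q : R) (n : nat) :
  0 < q -> q < 1 ->
  qfact2 q n = (qpoch (q ^ 2) (RtoC (q ^ 2)) n / RtoC ((1 - q ^ 2) ^ n))%C.
Proof.
  intros H0 H1. assert (Hp := sqr_lt1 q H0 H1). induction n as [|n IH].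
  - unfold qfact2, qpoch. simpl. field. apply RtoC_neq0; lra.
  - change (qfact2 q (S n)) with (qfact2 q n * qint2 q (RtoC (INR (S n))))%C.
    rewrite IH, qpoch_S. unfold qint2.
    change (qpow q (RtoC 2 * RtoC (INR (S n)))%C) with (q2pow q (RtoC (INR (S n)))).
    rewrite q2pow_nat by exact H0.
    rewrite <- !(tech_pow_Rmult _ n), !RtoC_mul. field.
    split; apply RtoC_neq0; try apply pow_nonzero; lra.
Qed.

(** * From the basic series to gamma quotients *)

Lemma Csum_scal (c : Cplx) (f : nat -> Cplx) (n : nat) :
  Csum n (fun k => c * f k)%C = (c * Csum n f)%C.
Proof. induction n as [|n IH]; simpl; [ring | rewrite IH; ring]. Qed.

Lemma Cseries_cv_scal (f g : nat -> Cplx) (c l : Cplx) :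
  (forall n, g n = (c * f n)%C) -> Cseq_cv (fun N => Csum N f) l ->
  Cseries_cv g (c * l)%C.
Proof.
  intros E H. unfold Cseries_cv.
  apply (Cseq_cv_ext (fun N => c * Csum (S N) f)%C).
  - intros N. rewrite <- Csum_scal.
    induction (S N) as [|m IH]; simpl; [reflexivity | now rewrite IH, E].
  - apply Cseq_cv_mul; [apply Cseq_cv_const|].
    now apply (Cseq_cv_incr (fun N => Csum N f)).
Qed.

Theorem theorem1p2 (q : R) (a b c d al be ga de : Cplx) :
  0 < q -> q < 1 ->
  Cre (a + b + c + d + RtoC 1 + al - be - ga - de)%C > 0 ->
  (* every Gamma_{q^2} value on the left-hand side is at a non-pole *)
  (forall n : nat,
     let N := RtoC (INR n) in
     qshift2_ok q al (a + N)%C /\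
     qshift2_ok q be (N - b)%C /\
     qshift2_ok q ga (N - c)%C /\
     qshift2_ok q de (N - d)%C /\
     qshift2_ok q (RtoC 1 + al - be)%C (a + b + N)%C /\
     qshift2_ok q (RtoC 1 + al - ga)%C (a + c + N)%C /\
     qshift2_ok q (RtoC 1 + al - de)%C (a + d + N)%C) ->
  (* every Gamma_{q^2} value on the right-hand side is at a non-pole *)
  ~ qgamma2_pole q (RtoC 1 + al - be)%C ->
  ~ qgamma2_pole q (RtoC 1 + al - ga)%C ->
  ~ qgamma2_pole q (RtoC 1 + al - de)%C ->
  ~ qgamma2_pole q (RtoC 2 + al - be - ga - de)%C ->
  ~ qgamma2_pole q al ->
  ~ qgamma2_pole q (RtoC 1 + al - be - ga)%C ->
  ~ qgamma2_pole q (RtoC 1 + al - be - de)%C ->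
  ~ qgamma2_pole q (RtoC 1 + al - ga - de)%C ->
  qshift2_ok q be (- b)%C ->
  qshift2_ok q ga (- c)%C ->
  qshift2_ok q de (- d)%C ->
  qshift2_ok q (RtoC 2 + al - be - ga - de)%C (a + b + c + d - RtoC 1)%C ->
  qshift2_ok q (RtoC 1 + al - be - ga)%C (a + b + c)%C ->
  qshift2_ok q (RtoC 1 + al - be - de)%C (a + b + d)%C ->
  qshift2_ok q (RtoC 1 + al - ga - de)%C (a + c + d)%C ->
  let A := (RtoC 2 * (a + b + c + d + RtoC 1 + al - be - ga - de))%C in
  Cseries_cv
    (fun n : nat =>
       let N := RtoC (INR n) in
       ((RtoC 1 - qpow q (RtoC 4 * N + RtoC 2 * a + RtoC 2 * al))
          * qshift2 q al (a + N) * qshift2 q be (N - b)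
          * qshift2 q ga (N - c) * qshift2 q de (N - d)
        / (RtoC (1 - q ^ 2) * qfact2 q n
           * qshift2 q (RtoC 1 + al - be) (a + b + N)
           * qshift2 q (RtoC 1 + al - ga) (a + c + N)
           * qshift2 q (RtoC 1 + al - de) (a + d + N))
        * qpow q (A * N))%C)
    ((qgamma2 q (RtoC 1 + al - be) * qgamma2 q (RtoC 1 + al - ga)
      * qgamma2 q (RtoC 1 + al - de) * qgamma2 q (RtoC 2 + al - be - ga - de)
      / (qgamma2 q al * qgamma2 q (RtoC 1 + al - be - ga)
         * qgamma2 q (RtoC 1 + al - be - de) * qgamma2 q (RtoC 1 + al - ga - de)))
     * (qshift2 q be (- b) * qshift2 q ga (- c) * qshift2 q de (- d)
        * qshift2 q (RtoC 2 + al - be - ga - de) (a + b + c + d - RtoC 1)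
        / (qshift2 q (RtoC 1 + al - be - ga) (a + b + c)
           * qshift2 q (RtoC 1 + al - be - de) (a + b + d)
           * qshift2 q (RtoC 1 + al - ga - de) (a + c + d))))%C.
Proof.
  intros H0 H1 HRe Hall P1 P2 P3 P4 P5 P6 P7 P8 S1 S2 S3 S4 S5 S6 S7 A.
  assert (Hp := sqr_lt1 q H0 H1).
  (* Exponents to base p = q^2: x, y, z, w belong to A, B, C, D; a compound name such as [xyz]
     belongs to pA/(BC), and [xyzw] to the argument of the series. *)
  set (x := (al + a)%C). set (y := (be - b)%C).
  set (z := (ga - c)%C). set (w := (de - d)%C).
  set (xy := (RtoC 1 + x - y)%C). set (xz := (RtoC 1 + x - z)%C).
  set (xw := (RtoC 1 + x - w)%C).
  set (xyz := (RtoC 1 + x - y - z)%C). set (xyw := (RtoC 1 + x - y - w)%C).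
  set (xzw := (RtoC 1 + x - z - w)%C). set (xyzw := (RtoC 1 + x - y - z - w)%C).
  assert (R2 : RtoC 2 = (RtoC 1 + RtoC 1)%C) by (rewrite <- RtoC_add; f_equal; ring).
  assert (E1 : forall n, (al + (a + RtoC (INR n)) = x + RtoC (INR n))%C)
    by (intros; unfold x; ring).
  assert (E2 : forall n, (be + (RtoC (INR n) - b) = y + RtoC (INR n))%C)
    by (intros; unfold y; ring).
  assert (E3 : forall n, (ga + (RtoC (INR n) - c) = z + RtoC (INR n))%C)
    by (intros; unfold z; ring).
  assert (E4 : forall n, (de + (RtoC (INR n) - d) = w + RtoC (INR n))%C)
    by (intros; unfold w; ring).
  assert (E5 : forall n, (RtoC 1 + al - be + (a + b + RtoC (INR n)) = xy + RtoC (INR n))%C)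
    by (intros; unfold xy, x, y; ring).
  assert (E6 : forall n, (RtoC 1 + al - ga + (a + c + RtoC (INR n)) = xz + RtoC (INR n))%C)
    by (intros; unfold xz, x, z; ring).
  assert (E7 : forall n, (RtoC 1 + al - de + (a + d + RtoC (INR n)) = xw + RtoC (INR n))%C)
    by (intros; unfold xw, x, w; ring).
  assert (F1 : (be + - b = y)%C) by (unfold y; ring).
  assert (F2 : (ga + - c = z)%C) by (unfold z; ring).
  assert (F3 : (de + - d = w)%C) by (unfold w; ring).
  assert (F4 : (RtoC 2 + al - be - ga - de + (a + b + c + d - RtoC 1) = xyzw)%C)
    by (rewrite R2; unfold xyzw, x, y, z, w; ring).
  assert (F5 : (RtoC 1 + al - be - ga + (a + b + c) = xyz)%C)
    by (unfold xyz, x, y, z; ring).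
  assert (F6 : (RtoC 1 + al - be - de + (a + b + d) = xyw)%C)
    by (unfold xyw, x, y, w; ring).
  assert (F7 : (RtoC 1 + al - ga - de + (a + c + d) = xzw)%C)
    by (unfold xzw, x, z, w; ring).
  assert (EA : A = (RtoC 2 * xyzw)%C) by (unfold A, xyzw, x, y, z, w; ring).
  (* The instance n = 0 gives the non-pole conditions at x, y, z, w, [xy], [xz], [xw] and at the
     bases be, ga, de. *)
  destruct (Hall O) as (Q1 & Q2 & Q3 & Q4 & Q5 & Q6 & Q7).
  unfold qshift2_ok in *.
  rewrite E1 in Q1. rewrite E2 in Q2. rewrite E3 in Q3. rewrite E4 in Q4.
  rewrite E5 in Q5. rewrite E6 in Q6. rewrite E7 in Q7.
  assert (E0 : forall u, (u + RtoC (INR 0))%C = u) by (intros; simpl; ring).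
  rewrite E0 in Q1, Q2, Q3, Q4, Q5, Q6, Q7.
  rewrite F4 in S4. rewrite F5 in S5. rewrite F6 in S6. rewrite F7 in S7.
  destruct Q1 as [_ Q1], Q2 as [B1 Q2], Q3 as [B2 Q3], Q4 as [B3 Q4], Q5 as [_ Q5],
    Q6 as [_ Q6], Q7 as [_ Q7], S4 as [_ S4], S5 as [_ S5], S6 as [_ S6], S7 as [_ S7].
  clear S1 S2 S3 Hall.
  assert (Nz : forall u, q2pow q u <> RtoC 0) by (intros; apply qpow_neq0).
  assert (X1 : q2pow q xy = (RtoC (q ^ 2) * q2pow q x / q2pow q y)%C)
    by (unfold xy; now rewrite q2pow_sub, q2pow_add, q2pow_1).
  assert (X2 : q2pow q xz = (RtoC (q ^ 2) * q2pow q x / q2pow q z)%C)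
    by (unfold xz; now rewrite q2pow_sub, q2pow_add, q2pow_1).
  assert (X3 : q2pow q xw = (RtoC (q ^ 2) * q2pow q x / q2pow q w)%C)
    by (unfold xw; now rewrite q2pow_sub, q2pow_add, q2pow_1).
  assert (X4 : q2pow q xyz = (RtoC (q ^ 2) * q2pow q x / (q2pow q y * q2pow q z))%C)
    by (unfold xyz; rewrite !q2pow_sub, q2pow_add, q2pow_1 by trivial; field; auto).
  assert (X5 : q2pow q xyw = (RtoC (q ^ 2) * q2pow q x / (q2pow q y * q2pow q w))%C)
    by (unfold xyw; rewrite !q2pow_sub, q2pow_add, q2pow_1 by trivial; field; auto).
  assert (X6 : q2pow q xzw = (RtoC (q ^ 2) * q2pow q x / (q2pow q z * q2pow q w))%C)
    by (unfold xzw; rewrite !q2pow_sub, q2pow_add, q2pow_1 by trivial; field; auto).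
  assert (X7 : q2pow q xyzw = wp_arg (q ^ 2) (q2pow q x) (q2pow q y) (q2pow q z) (q2pow q w))
    by (unfold xyzw, wp_arg; rewrite !q2pow_sub, q2pow_add, q2pow_1 by trivial; field; auto).
  (* The real-part hypothesis is the convergence condition: the modulus is exp (2 Re(xyzw) ln q),
     and ln q < 0. *)
  assert (Hz : Cmod (q2pow q xyzw) < 1).
  { unfold q2pow. rewrite Cmod_qpow, <- exp_0. apply exp_increasing.
    rewrite <- EA. unfold A.
    assert (L := ln_increasing q 1 H0 H1). rewrite ln_1 in L.
    set (s := (a + b + c + d + RtoC 1 + al - be - ga - de)%C) in *.
    replace (Cre (RtoC 2 * s)%C) with (2 * Cre s) by (unfold Cre; simpl; ring). nra. }
  assert (Hr : wp_regular (q ^ 2) (q2pow q x) (q2pow q y) (q2pow q z) (q2pow q w)).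
  { unfold wp_regular. rewrite <- X1, <- X2, <- X3, <- X7.
    repeat split; trivial; now apply q_regular_of_not_pole. }
  assert (main := wp_6phi5_sum _ _ _ _ _ Hp Hr).
  rewrite <- X1, <- X2, <- X3, <- X4, <- X5, <- X6, <- X7 in main.
  rewrite !qpoch_inf_qgamma2 in main by trivial.
  unfold qshift2. rewrite F1, F2, F3, F4, F5, F6, F7.
  assert (N1 : RtoC (1 - q ^ 2) <> RtoC 0) by (apply RtoC_neq0; lra).
  assert (M1 := qgamma2_neq0 q _ H0 H1 P1). assert (M2 := qgamma2_neq0 q _ H0 H1 P2).
  assert (M3 := qgamma2_neq0 q _ H0 H1 P3). assert (M4 := qgamma2_neq0 q _ H0 H1 P5).
  assert (M5 := qgamma2_neq0 q _ H0 H1 B1). assert (M6 := qgamma2_neq0 q _ H0 H1 B2).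
  assert (M7 := qgamma2_neq0 q _ H0 H1 B3). assert (M8 := qgamma2_neq0 q _ H0 H1 Q5).
  assert (M9 := qgamma2_neq0 q _ H0 H1 Q6). assert (M10 := qgamma2_neq0 q _ H0 H1 Q7).
  (* The displayed constant is the part of the summand free of n. Transport along an equality of
     limits leaves two goals: the termwise identity and the identity of the two closed forms. *)
  apply (fun E => eq_ind _ (Cseries_cv _) (Cseries_cv_scal _ _
    (qgamma2 q x * qgamma2 q y * qgamma2 q z * qgamma2 q w
     / (qgamma2 q al * qgamma2 q be * qgamma2 q ga * qgamma2 q de)
     * (qgamma2 q (RtoC 1 + al - be) * qgamma2 q (RtoC 1 + al - ga)
        * qgamma2 q (RtoC 1 + al - de) / (qgamma2 q xy * qgamma2 q xz * qgamma2 q xw))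
     / RtoC (1 - q ^ 2))%C _ E main)).
  - intros n. cbv zeta. rewrite E1, E2, E3, E4, E5, E6, E7.
    rewrite !qgamma2_add_nat, qfact2_eq, EA, qpow_mul_nat by trivial.
    change (qpow q (RtoC 2 * xyzw)%C) with (q2pow q xyzw).
    (* This is A p^(2n), with A = q^(2x): the very-well-poised factor of [wp_term]. *)
    replace (qpow q (RtoC 4 * RtoC (INR n) + RtoC 2 * a + RtoC 2 * al)%C)
      with (q2pow q x * RtoC ((q ^ 2) ^ n) * RtoC ((q ^ 2) ^ n))%C.
    2: { rewrite <- q2pow_nat, <- !q2pow_add by exact H0. unfold q2pow. f_equal.
         replace 4 with (2 * 2) by ring. rewrite RtoC_mul, R2. unfold x. ring. }
    unfold wp_term, wp_coef. rewrite <- X1, <- X2, <- X3, <- X7.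
    assert (L1 := qpoch_neq0 _ _ n (q_regular_of_not_pole _ _ Q5)).
    assert (L2 := qpoch_neq0 _ _ n (q_regular_of_not_pole _ _ Q6)).
    assert (L3 := qpoch_neq0 _ _ n (q_regular_of_not_pole _ _ Q7)).
    assert (L4 := qpoch_neq0 _ _ n (q_regular_self _ Hp)).
    assert (L5 : RtoC ((1 - q ^ 2) ^ n) <> RtoC 0)
      by (apply RtoC_neq0, pow_nonzero; lra).
    generalize dependent (RtoC (1 - q ^ 2)). generalize dependent (RtoC ((1 - q ^ 2) ^ n)).
    intros g L5 h N1.
    generalize dependent (qgamma2 q (RtoC 1 + al - be)%C).
    generalize dependent (qgamma2 q (RtoC 1 + al - ga)%C).
    generalize dependent (qgamma2 q (RtoC 1 + al - de)%C). intros g3 M3 g2 M2 g1 M1.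
    field. repeat split; trivial.
  - assert (L1 := qgamma2_neq0 q _ H0 H1 P4). assert (L2 := qgamma2_neq0 q _ H0 H1 P6).
    assert (L3 := qgamma2_neq0 q _ H0 H1 P7). assert (L4 := qgamma2_neq0 q _ H0 H1 P8).
    assert (L5 := qgamma2_neq0 q _ H0 H1 S4). assert (L6 := qgamma2_neq0 q _ H0 H1 S5).
    assert (L7 := qgamma2_neq0 q _ H0 H1 S6). assert (L8 := qgamma2_neq0 q _ H0 H1 S7).
    assert (L9 := qgamma2_neq0 q _ H0 H1 Q1).
    assert (K0 := qpoch_inf_neq0 _ _ Hp (q_regular_self _ Hp)).
    assert (W : forall u, qpow (1 - q ^ 2) u <> RtoC 0) by (intros; apply qpow_neq0).
    set (g := qgamma2 q) in *. set (v := qpow (1 - q ^ 2)) in *.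
    assert (V1 : v (RtoC 1) = RtoC (1 - q ^ 2)) by (apply qpow_1; lra).
    assert (Vs : forall s t, v (s - t)%C = (v s / v t)%C) by (intros; apply qpow_sub).
    assert (Va : forall s t, v (s + t)%C = (v s * v t)%C) by (intros; apply qpow_add).
    (* All powers of 1 - q^2 are reduced to those with exponents x, y, z, w. They cancel between
       numerator and denominator except for the single 1 - q^2 produced here, which meets the 1/(1 -
       q^2) of the constant. *)
    replace (v (RtoC 1 - x)%C) with (RtoC (1 - q ^ 2) / v x)%C by now rewrite Vs, V1.
    replace (v (RtoC 1 - xy)%C) with (v y / v x)%C
      by (unfold xy; rewrite !Vs, Va; field; auto).
    replace (v (RtoC 1 - xz)%C) with (v z / v x)%C
      by (unfold xz; rewrite !Vs, Va; field; auto).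
    replace (v (RtoC 1 - xw)%C) with (v w / v x)%C
      by (unfold xw; rewrite !Vs, Va; field; auto).
    replace (v (RtoC 1 - xyz)%C) with (v y * v z / v x)%C
      by (unfold xyz; rewrite !Vs, Va; field; auto).
    replace (v (RtoC 1 - xyw)%C) with (v y * v w / v x)%C
      by (unfold xyw; rewrite !Vs, Va; field; auto).
    replace (v (RtoC 1 - xzw)%C) with (v z * v w / v x)%C
      by (unfold xzw; rewrite !Vs, Va; field; auto).
    replace (v (RtoC 1 - xyzw)%C) with (v y * v z * v w / v x)%C
      by (unfold xyzw; rewrite !Vs, Va; field; auto).
    generalize dependent (g (RtoC 1 + al - be)%C).
    generalize dependent (g (RtoC 1 + al - ga)%C).
    generalize dependent (g (RtoC 1 + al - de)%C).
    generalize dependent (g (RtoC 1 + al - be - ga)%C).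
    generalize dependent (g (RtoC 1 + al - be - de)%C).
    generalize dependent (g (RtoC 1 + al - ga - de)%C).
    generalize dependent (g (RtoC 2 + al - be - ga - de)%C). intros.
    field. repeat split; trivial.
Qed.
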